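(* Let $d$ be the Dottie number, i.e. the unique real solution of $x=\cos x$. Then $$d=\mathrm{inverse}_1(y_0)(-1),$$ where $y_0(x)=-\frac{\cos x}{x}$ is the spherical Bessel function of the second kind of order $0$ and the subscript $1$ is the branch number.
   Context: Branches of the inverse of $y_0(x)=-\cos x/x$ ($x\in\mathbb{R}\setminus\{0\}$): the real $x\neq0$ are partitioned into maximal intervals on which $y_0$ is continuous and monotonic. The endpoints of these intervals (abscissas of local infima and suprema, including the pole $x=0$) are called infsupum abscissas and are numbered consecutively in increasing order by integers $m$, so that number $1$ is the least positive one, $x_{0,1}\approx 2.79839$, and number $0$ is the pole $x_{0,0}=0$. Branch number $b$ is the interval $[x_{0,b-1},x_{0,b})$ (a pole endpoint being excluded); in particular branch $1$ is $(0,x_{0,1})$. For $c$ in the image of branch interval $b$ under $y_0$, $\mathrm{inverse}_b(y_0)(c)$ denotes the unique $x$ in branch interval $b$ with $y_0(x)=c$. *)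

(* Defs.v *)
From Stdlib Require Import Reals ZArith ClassicalEpsilon.
From Coquelicot Require Import Coquelicot.
Open Scope R_scope.

(* Definite description over R: meaningful only when [exists! x, P x]. *)
Definition the (P : R -> Prop) : R := epsilon (inhabits 0) P.

Definition dottie : R := the (fun x => x = cos x).

(* Division is total in Rocq, so the domain of a partial function is kept as a
   separate predicate [D]; the value [y0 0] is never used. *)
Definition y0 (x : R) : R := - cos x / x.
Definition y0_dom (x : R) : Prop := x <> 0.

Definition is_interval (I : R -> Prop) : Prop :=
  forall x y z, I x -> I z -> x <= y <= z -> I y.

Definition monotonic_on (f : R -> R) (I : R -> Prop) : Prop :=
  (forall x y, I x -> I y -> x <= y -> f x <= f y) \/
  (forall x y, I x -> I y -> x <= y -> f y <= f x).

Definition cont_mono_interval (D : R -> Prop) (f : R -> R)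
    (I : R -> Prop) : Prop :=
  is_interval I /\ (forall x, I x -> D x) /\
  continuous_on I f /\ monotonic_on f I.

(* Neighbouring maximal intervals share their common endpoint when it lies in
   the domain; [branch] below assigns it to the interval on its right. *)
Definition maximal_cont_mono_interval (D : R -> Prop) (f : R -> R)
    (I : R -> Prop) : Prop :=
  cont_mono_interval D f I /\
  forall J, cont_mono_interval D f J ->
    (forall x, I x -> J x) -> forall x, J x -> I x.

(* Finite endpoints only: the bounds are taken in the extended reals. *)
Definition infsupum_abscissa (D : R -> Prop) (f : R -> R) (e : R) : Prop :=
  exists I, maximal_cont_mono_interval D f I /\
    (is_glb_Rbar I (Finite e) \/ is_lub_Rbar I (Finite e)).

(* Increasing enumeration by all of Z, without gaps or repetitions, in which
   number 1 is the least positive abscissa. *)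
Definition infsupum_numbering (D : R -> Prop) (f : R -> R)
    (nu : Z -> R) : Prop :=
  (forall m n : Z, (m < n)%Z -> nu m < nu n) /\
  (forall e, infsupum_abscissa D f e <-> exists m, nu m = e) /\
  0 < nu 1%Z /\ (forall e, infsupum_abscissa D f e -> 0 < e -> nu 1%Z <= e).

(* Meaningful only when there is a unique numbering. *)
Definition infsupum (D : R -> Prop) (f : R -> R) : Z -> R :=
  epsilon (inhabits (fun _ : Z => 0)) (infsupum_numbering D f).

Definition branch (D : R -> Prop) (f : R -> R) (b : Z) (x : R) : Prop :=
  D x /\ infsupum D f (b - 1) <= x < infsupum D f b.

Definition inverse (D : R -> Prop) (f : R -> R) (b : Z) (c : R) : R :=
  the (fun x => branch D f b x /\ f x = c).

(* Main.v *)
Require Import Defs.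
From Stdlib Require Import Reals ZArith Lra Lia Classical ClassicalEpsilon
  FunctionalExtensionality.
From Coquelicot Require Import Coquelicot.
Open Scope R_scope.

(** The derivative of [y0] is [(x sin x + cos x) / x^2], and its numerator is
    [sqrt (1 + x^2) * cos (x - atan x)]. The phase [x - atan x] is an increasing
    bijection of the line that fixes 0 ([phase_increasing], [phase_surjective]),
    so [y0'] changes sign exactly where the phase is an odd multiple of [PI/2].
    Adding the pole, where the phase is 0, the infsupum abscissas in increasing
    order are the points [abscissa m] of phase [(2m - sgn m) PI/2].

    Between consecutive abscissas [y0] is continuous and strictly monotonic
    ([y0_strictly_monotonic]), and no interval of the domain on which [y0] is
    monotonic goes across an abscissa ([no_crossing]): [y0] changes direction at
    a zero of [y0'], and the pole is not in the domain. These two facts force the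
    maximal intervals to be the pieces cut out by the abscissas
    ([infsupum_abscissa_of_partition]). An increasing numbering by [Z] is
    determined by its range and the position of number 1
    ([infsupum_numbering_unique]), hence [infsupum] is [abscissa] and branch 1
    is the set of [x > 0] of phase less than [PI/2].

    On [x <> 0] the equation [y0 x = -1] says [x = cos x]. The Dottie number
    lies in (0, 1], where the phase is less than [x <= 1 < PI/2], so it is the
    point of branch 1 with value [-1]. *)

(** * Maximal intervals of a partition *)

Lemma glb_lub_of_open_interval (E : R -> Prop) (a b : R) :
  a < b -> (forall x, a < x < b -> E x) -> (forall x, E x -> a <= x <= b) ->
  is_glb_Rbar E (Finite a) /\ is_lub_Rbar E (Finite b).
Proof.
intros ab Hin Hout. repeat split.
- intros x Ex. simpl. apply Hout; exact Ex.
- intros [r| |] Hr; simpl; trivial.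
  + destruct (Rle_or_lt r a) as [H|H]; trivial. exfalso.
    assert (m : a < Rmin r b) by (apply Rmin_glb_lt; lra).
    pose proof (Rmin_l r b). pose proof (Rmin_r r b).
    assert (H2 : E ((a + Rmin r b) / 2)) by (apply Hin; lra).
    apply Hr in H2. simpl in H2. lra.
  + assert (H2 : E ((a + b) / 2)) by (apply Hin; lra).
    apply Hr in H2. exact H2.
- intros x Ex. simpl. apply Hout; exact Ex.
- intros [r| |] Hr; simpl; trivial.
  + destruct (Rle_or_lt b r) as [H|H]; trivial. exfalso.
    assert (m : Rmax a r < b) by (apply Rmax_lub_lt; lra).
    pose proof (Rmax_l a r). pose proof (Rmax_r a r).
    assert (H2 : E ((Rmax a r + b) / 2)) by (apply Hin; lra).
    apply Hr in H2. simpl in H2. lra.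
  + assert (H2 : E ((a + b) / 2)) by (apply Hin; lra).
    apply Hr in H2. exact H2.
Qed.

(** The hypothesis on crossings gives both directions: it puts any admissible
    interval inside one piece, and it prevents a piece from being enlarged. *)
Lemma infsupum_abscissa_of_partition (D : R -> Prop) (f : R -> R) (nu : Z -> R) :
  (forall m n : Z, (m < n)%Z -> nu m < nu n) ->
  (forall x, exists k : Z, nu k <= x < nu (k + 1)%Z) ->
  (forall (k : Z) x, nu k < x < nu (k + 1)%Z -> D x) ->
  (forall k : Z,
     cont_mono_interval D f (fun x => D x /\ nu k <= x <= nu (k + 1)%Z)) ->
  (forall I, cont_mono_interval D f I ->
     forall (m : Z) a b, I a -> I b -> ~ (a < nu m < b)) ->
  forall e, infsupum_abscissa D f e <-> exists m : Z, nu m = e.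
Proof.
intros inc loc dom piece cross.
assert (step : forall k, nu k < nu (k + 1)%Z) by (intro k; apply inc; lia).
assert (contained : forall I x0, cont_mono_interval D f I -> I x0 ->
          exists k : Z, forall x, I x -> D x /\ nu k <= x <= nu (k + 1)%Z).
{ intros I x0 HI Ix0.
  assert (ID : forall x, I x -> D x) by apply HI.
  destruct (loc x0) as [k Hk].
  destruct (classic (exists y, I y /\ nu k < y)) as [[y [Iy Hy]]|H].
  - exists k. intros x Ix. split; [auto|]. split.
    + apply Rnot_lt_le. intro. apply (cross I HI k x y); auto.
    + apply Rnot_lt_le. intro. apply (cross I HI (k + 1)%Z x0 x); auto; lra.
  - assert (H' : forall y, I y -> y <= nu k).
    { intros y Iy. apply Rnot_lt_le. intro. apply H. exists y; auto. }
    (* Here [x0] is the endpoint [nu k] and [I] lies to its left. *)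
    exists (k - 1)%Z. replace (k - 1 + 1)%Z with k by lia.
    intros x Ix. split; [auto|]. split; [|auto].
    apply Rnot_lt_le. intro. apply (cross I HI (k - 1)%Z x x0); auto.
    pose proof (step (k - 1)%Z) as S. replace (k - 1 + 1)%Z with k in S by lia.
    lra. }
assert (maxpiece : forall k : Z, maximal_cont_mono_interval D f
          (fun x => D x /\ nu k <= x <= nu (k + 1)%Z)).
{ intro k. split; [apply piece|].
  intros J HJ sub y Jy.
  assert (JD : forall x, J x -> D x) by apply HJ.
  pose proof (step k) as S.
  assert (Jmid : J ((nu k + nu (k + 1)%Z) / 2)).
  { apply sub. split; [apply (dom k)|]; lra. }
  split; [auto|]. split; apply Rnot_lt_le; intro H.
  - apply (cross J HJ k y _ Jy Jmid). lra.
  - apply (cross J HJ (k + 1)%Z _ y Jmid Jy). lra. }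
intro e. split.
- intros [I [[HI maxI] He]].
  assert (nonempty : exists x0, I x0).
  { apply NNPP. intro emp. destruct He as [[_ H]|[_ H]].
    - apply (H p_infty). intros x Ix. apply emp. exists x; exact Ix.
    - apply (H m_infty). intros x Ix. apply emp. exists x; exact Ix. }
  destruct nonempty as [x0 Ix0].
  destruct (contained I x0 HI Ix0) as [k Hk].
  pose proof (maxI _ (piece k) Hk) as Hk'.
  destruct (glb_lub_of_open_interval I (nu k) (nu (k + 1)%Z) (step k))
    as [Hg Hl].
  + intros x Hx. apply Hk'. split; [apply (dom k); exact Hx | lra].
  + intros x Ix. apply Hk; exact Ix.
  + destruct He as [He|He].
    * exists k. apply is_glb_Rbar_unique in He. apply is_glb_Rbar_unique in Hg.
      rewrite He in Hg. injection Hg; auto.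
    * exists (k + 1)%Z.
      apply is_lub_Rbar_unique in He. apply is_lub_Rbar_unique in Hl.
      rewrite He in Hl. injection Hl; auto.
- intros [m <-].
  exists (fun x => D x /\ nu m <= x <= nu (m + 1)%Z).
  split; [apply maxpiece|]. left.
  apply (glb_lub_of_open_interval _ (nu m) (nu (m + 1)%Z) (step m)).
  + intros x Hx. split; [apply (dom m); exact Hx | lra].
  + intros x Hx. apply Hx.
Qed.

(** * Uniqueness of the numbering *)

Lemma increasing_Z_reflects (nu : Z -> R) :
  (forall m n : Z, (m < n)%Z -> nu m < nu n) ->
  forall m n : Z, nu m < nu n -> (m < n)%Z.
Proof.
intros inc m n H.
destruct (Z.lt_total m n) as [L|[L|L]]; trivial.
- subst; lra.
- apply inc in L; lra.
Qed.

(** [nu (m + 1)] is the least value of [nu] above [nu m] and [nu (m - 1)] the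
    greatest below it, so equality at one index spreads in both directions. *)
Lemma increasing_enumeration_unique (nu nu' : Z -> R) (m0 : Z) :
  (forall m n : Z, (m < n)%Z -> nu m < nu n) ->
  (forall m n : Z, (m < n)%Z -> nu' m < nu' n) ->
  (forall e, (exists m, nu m = e) <-> (exists m, nu' m = e)) ->
  nu m0 = nu' m0 -> nu = nu'.
Proof.
intros inc inc' range E0.
assert (half : forall u v : Z -> R,
  (forall m n : Z, (m < n)%Z -> u m < u n) ->
  (forall m n : Z, (m < n)%Z -> v m < v n) ->
  (forall e, (exists m, u m = e) -> exists m, v m = e) ->
  forall m, u m = v m ->
    v (m + 1)%Z <= u (m + 1)%Z /\ u (m - 1)%Z <= v (m - 1)%Z).
{ intros u v iu iv r m Em.
  assert (le : forall i j : Z, (i <= j)%Z -> v i <= v j).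
  { intros i j Hij. destruct (Zle_lt_or_eq i j Hij) as [L|L].
    - left; auto.
    - subst; lra. }
  split.
  - destruct (r (u (m + 1)%Z)) as [j Hj]; [eauto|].
    rewrite <- Hj. apply le.
    assert (m < j)%Z; [|lia].
    apply (increasing_Z_reflects v iv). rewrite Hj, <- Em. apply iu; lia.
  - destruct (r (u (m - 1)%Z)) as [j Hj]; [eauto|].
    rewrite <- Hj. apply le.
    assert (j < m)%Z; [|lia].
    apply (increasing_Z_reflects v iv). rewrite Hj, <- Em. apply iu; lia. }
assert (ladder : forall n : nat,
  nu (m0 + Z.of_nat n)%Z = nu' (m0 + Z.of_nat n)%Z /\
  nu (m0 - Z.of_nat n)%Z = nu' (m0 - Z.of_nat n)%Z).
{ induction n as [|n [IHu IHd]].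
  - rewrite Z.add_0_r, Z.sub_0_r. auto.
  - replace (m0 + Z.of_nat (S n))%Z with (m0 + Z.of_nat n + 1)%Z by lia.
    replace (m0 - Z.of_nat (S n))%Z with (m0 - Z.of_nat n - 1)%Z by lia.
    split; apply Rle_antisym.
    + apply (half nu' nu); auto. intro e; apply range.
    + apply (half nu nu'); auto. intro e; apply range.
    + apply (half nu nu'); auto. intro e; apply range.
    + apply (half nu' nu); auto. intro e; apply range. }
apply functional_extensionality. intro m.
destruct (Z_le_gt_dec m0 m) as [L|L].
- destruct (ladder (Z.to_nat (m - m0))) as [H _].
  replace (m0 + Z.of_nat (Z.to_nat (m - m0)))%Z with m in H by lia. exact H.
- destruct (ladder (Z.to_nat (m0 - m))) as [_ H].
  replace (m0 - Z.of_nat (Z.to_nat (m0 - m)))%Z with m in H by lia. exact H.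
Qed.

Lemma infsupum_numbering_unique (D : R -> Prop) (f : R -> R) (nu nu' : Z -> R) :
  infsupum_numbering D f nu -> infsupum_numbering D f nu' -> nu = nu'.
Proof.
intros [inc [range [pos least]]] [inc' [range' [pos' least']]].
apply (increasing_enumeration_unique nu nu' 1); auto.
- intro e. rewrite <- range, <- range'. reflexivity.
- apply Rle_antisym.
  + apply least; [apply range'; eauto | exact pos'].
  + apply least'; [apply range; eauto | exact pos].
Qed.

(** * The phase of the derivative *)

Definition phase (x : R) : R := x - atan x.

Lemma phase_derive (x : R) :
  derivable_pt_lim phase x (1 - / (1 + x ^ 2)).
Proof.
apply derivable_pt_lim_minus;
  [apply derivable_pt_lim_id | apply derivable_pt_lim_atan].
Qed.

Lemma phase_0 : phase 0 = 0.
Proof. unfold phase. rewrite atan_0. ring. Qed.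

(** The derivative [x^2 / (1 + x^2)] vanishes at 0 only, so an interval around
    0 is split there. *)
Lemma phase_increasing (a b : R) : a < b -> phase a < phase b.
Proof.
assert (away : forall a b, a < b -> 0 <= a \/ b <= 0 -> phase a < phase b).
{ clear a b. intros a b ab side.
  destruct (MVT_cor2 phase (fun x => 1 - / (1 + x ^ 2)) a b ab) as [c [E Hc]].
  { intros c _. apply phase_derive. }
  assert (0 < 1 - / (1 + c ^ 2)); [|nra].
  assert (0 < c ^ 2) by (destruct side; nra).
  assert (/ (1 + c ^ 2) < / 1); [apply Rinv_lt_contravar; lra | lra]. }
intro ab.
destruct (Rle_or_lt 0 a) as [Ha|Ha]; [apply away; lra|].
destruct (Rle_or_lt b 0) as [Hb|Hb]; [apply away; lra|].
apply Rlt_trans with (phase 0); apply away; lra.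
Qed.

Lemma phase_lt_iff (a b : R) : phase a < phase b <-> a < b.
Proof.
split; [|apply phase_increasing].
intro H. destruct (Rtotal_order a b) as [L|[L|L]]; trivial.
- subst; lra.
- apply phase_increasing in L; lra.
Qed.

Lemma phase_le_iff (a b : R) : phase a <= phase b <-> a <= b.
Proof.
split; intro H; apply Rnot_lt_le; intro L.
- apply phase_increasing in L. lra.
- rewrite phase_lt_iff in L. lra.
Qed.

Lemma phase_surjective (y : R) : {x : R | phase x = y}.
Proof.
destruct (IVT_gen phase (y - PI) (y + PI) y) as [x [_ Hx]].
- intro x. apply derivable_continuous_pt.
  exists (1 - / (1 + x ^ 2)). apply phase_derive.
- pose proof PI_RGT_0.
  (* The phase differs from its argument by less than [PI/2]. *)
  pose proof (atan_bound (y - PI)). pose proof (atan_bound (y + PI)).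
  assert (phase (y - PI) <= phase (y + PI)) by (apply phase_le_iff; lra).
  rewrite Rmin_left, Rmax_right by assumption. unfold phase; lra.
- exists x; exact Hx.
Qed.

Lemma cos_phase (x : R) : cos (phase x) = (x * sin x + cos x) * cos (atan x).
Proof.
unfold phase. rewrite cos_minus, sin_atan, cos_atan.
field. apply Rgt_not_eq, sqrt_lt_R0. pose proof (Rle_0_sqr x). lra.
Qed.

(** * Strict monotonicity of y0 *)

Lemma y0_derive (x : R) :
  x <> 0 -> is_derive y0 x ((x * sin x + cos x) / x ^ 2).
Proof.
intro Hx. unfold y0. auto_derive; [exact Hx|]. field; exact Hx.
Qed.

Lemma cos_shift_IZR_PI (c : Z) (t : R) :
  cos (t - IZR c * PI) = cos (IZR c * PI) * cos t.
Proof.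
rewrite cos_minus, (sin_eq_0_1 (IZR c * PI)) by eauto. ring.
Qed.

Lemma cos_succ_IZR_PI (c : Z) : cos (IZR (c + 1) * PI) = - cos (IZR c * PI).
Proof.
rewrite plus_IZR. replace ((IZR c + 1) * PI) with (IZR c * PI + PI) by ring.
apply neg_cos.
Qed.

(** The factor [cos (c * PI)] is the sign [(-1)^c] of [cos] on the half turn
    centred at [c * PI]. *)
Lemma y0_strictly_monotonic (c : Z) (a b : R) :
  a < b -> (forall x, a <= x <= b -> x <> 0) ->
  IZR (2 * c - 1) * (PI / 2) <= phase a ->
  phase b <= IZR (2 * c + 1) * (PI / 2) ->
  0 < cos (IZR c * PI) * (y0 b - y0 a).
Proof.
intros ab nz Ha Hb.
rewrite minus_IZR, mult_IZR in Ha. rewrite plus_IZR, mult_IZR in Hb.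
destruct (MVT_cor2 y0 (fun x => (x * sin x + cos x) / x ^ 2) a b ab)
  as [x [E Hx]].
{ intros x Hx. apply is_derive_Reals, y0_derive, nz, Hx. }
rewrite E.
pose proof (phase_increasing a x (proj1 Hx)).
pose proof (phase_increasing x b (proj2 Hx)).
assert (P : 0 < cos (phase x - IZR c * PI)) by (apply cos_gt_0; lra).
rewrite cos_shift_IZR_PI, cos_phase in P.
assert (Q : 0 < cos (atan x)).
{ pose proof (atan_bound x). apply cos_gt_0; lra. }
assert (S : 0 < cos (IZR c * PI) * (x * sin x + cos x)).
{ apply Rmult_lt_reg_r with (cos (atan x)); lra. }
assert (x2 : 0 < / x ^ 2).
{ apply Rinv_0_lt_compat, pow2_gt_0, nz. lra. }
replace (cos (IZR c * PI) * ((x * sin x + cos x) / x ^ 2 * (b - a)))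
  with (cos (IZR c * PI) * (x * sin x + cos x) * (/ x ^ 2 * (b - a)))
  by (unfold Rdiv; ring).
apply Rmult_lt_0_compat; [exact S|]. apply Rmult_lt_0_compat; lra.
Qed.

(** * The abscissas *)

(** Odd multiples of a quarter turn for [m <> 0], and 0 for the pole. *)
Definition quarter_turns (m : Z) : Z := (2 * m - Z.sgn m)%Z.

Definition abscissa (m : Z) : R :=
  proj1_sig (phase_surjective (IZR (quarter_turns m) * (PI / 2))).

Lemma phase_abscissa (m : Z) :
  phase (abscissa m) = IZR (quarter_turns m) * (PI / 2).
Proof. unfold abscissa. destruct (phase_surjective _) as [x Hx]. exact Hx. Qed.

Lemma quarter_multiple_le (m n : Z) :
  (m <= n)%Z -> IZR m * (PI / 2) <= IZR n * (PI / 2).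
Proof.
intro H. apply IZR_le in H. pose proof PI_RGT_0.
apply Rmult_le_compat_r; lra.
Qed.

Lemma abscissa_increasing (m n : Z) : (m < n)%Z -> abscissa m < abscissa n.
Proof.
intro H. apply phase_lt_iff. rewrite !phase_abscissa.
pose proof PI_RGT_0. apply Rmult_lt_compat_r; [lra|].
apply IZR_lt. unfold quarter_turns. lia.
Qed.

Lemma abscissa_0 : abscissa 0 = 0.
Proof.
assert (E : phase (abscissa 0) = phase 0).
{ rewrite phase_abscissa, phase_0. unfold quarter_turns. simpl. ring. }
apply Rle_antisym; apply phase_le_iff; lra.
Qed.

Lemma abscissa_locate (x : R) :
  exists k : Z, abscissa k <= x < abscissa (k + 1).
Proof.
pose proof PI_RGT_0 as Ppi.
set (r := phase x / (PI / 2)).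
assert (Er : phase x = r * (PI / 2)) by (unfold r; field; lra).
destruct (base_Int_part r) as [L U]. set (n := Int_part r) in *.
assert (K : exists k, (quarter_turns k <= n)%Z /\
                      (n + 1 <= quarter_turns (k + 1))%Z).
{ unfold quarter_turns.
  (* The pole shifts the indices by one between the two sides of 0. *)
  destruct (Z_le_gt_dec 0 n).
  - exists ((n + 1) / 2)%Z. split; Z.div_mod_to_equations; lia.
  - exists ((n - 1) / 2)%Z. split; Z.div_mod_to_equations; lia. }
destruct K as [k [K1 K2]]. exists k.
rewrite <- phase_le_iff, <- phase_lt_iff, !phase_abscissa.
apply quarter_multiple_le in K1. apply quarter_multiple_le in K2.
rewrite plus_IZR in K2. split.
- apply Rle_trans with (1 := K1). rewrite Er.
  apply Rmult_le_compat_r; lra.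
- apply Rlt_le_trans with (2 := K2). rewrite Er.
  apply Rmult_lt_compat_r; lra.
Qed.

Lemma abscissa_gap_nonzero (k : Z) (x : R) :
  abscissa k < x < abscissa (k + 1) -> x <> 0.
Proof.
intros Hx x0. rewrite x0, <- abscissa_0 in Hx.
destruct Hx as [H1 H2].
apply (increasing_Z_reflects abscissa abscissa_increasing) in H1.
apply (increasing_Z_reflects abscissa abscissa_increasing) in H2. lia.
Qed.

Lemma y0_piece (k : Z) :
  cont_mono_interval y0_dom y0
    (fun x => y0_dom x /\ abscissa k <= x <= abscissa (k + 1)).
Proof.
assert (itv : is_interval
          (fun x => y0_dom x /\ abscissa k <= x <= abscissa (k + 1))).
{ intros x y z [Dx Hx] [Dz Hz] Hy. split; [|lra].
  destruct (Req_dec y x) as [->|nx]; [exact Dx|].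
  destruct (Req_dec y z) as [->|nz]; [exact Dz|].
  apply (abscissa_gap_nonzero k); lra. }
split; [exact itv|]. split; [intros x [Dx _]; exact Dx|]. split.
- intros x [Dx _].
  eapply filterlim_filter_le_1; [apply filter_le_within|].
  apply (ex_derive_continuous y0 x). eexists. apply y0_derive, Dx.
- assert (C : exists c : Z, (2 * c - 1 <= quarter_turns k)%Z /\
                            (quarter_turns (k + 1) <= 2 * c + 1)%Z).
  { unfold quarter_turns. destruct (Z_le_gt_dec 0 k).
    - exists k. lia.
    - exists (k + 1)%Z. lia. }
  destruct C as [c [C1 C2]].
  apply quarter_multiple_le in C1. apply quarter_multiple_le in C2.
  rewrite <- phase_abscissa in C1, C2.
  assert (S : forall x y, y0_dom x /\ abscissa k <= x <= abscissa (k + 1) ->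
            y0_dom y /\ abscissa k <= y <= abscissa (k + 1) -> x < y ->
            0 < cos (IZR c * PI) * (y0 y - y0 x)).
  { intros x y Hx Hy xy. apply y0_strictly_monotonic; trivial.
    - intros t Ht. apply (itv x t y Hx Hy Ht).
    - apply Rle_trans with (1 := C1), phase_le_iff, Hx.
    - apply Rle_trans with (2 := C2), phase_le_iff, Hy. }
  destruct (Rle_or_lt 0 (cos (IZR c * PI))) as [P|P]; [left|right];
    intros x y Hx Hy [xy| ->]; try lra;
    specialize (S x y Hx Hy xy); nra.
Qed.

(** Close to a zero of [y0'] the phase passes from the half turn centred at
    [c * PI] to the next one, where the sign of [y0'] is opposite. At the pole
    the interval would leave the domain. *)
Lemma no_crossing (I : R -> Prop) :
  cont_mono_interval y0_dom y0 I ->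
  forall (m : Z) a b, I a -> I b -> ~ (a < abscissa m < b).
Proof.
intros [itv [dom [_ mono]]] m a b Ia Ib [Ha Hb].
assert (Im : I (abscissa m)) by (apply (itv a _ b); trivial; lra).
assert (m0 : m <> 0%Z).
{ intros ->. apply dom in Im. apply Im, abscissa_0. }
assert (C : exists c : Z, quarter_turns m = (2 * c + 1)%Z /\
    (2 * c - 1 <= quarter_turns (m - 1))%Z /\
    (quarter_turns (m + 1) <= 2 * (c + 1) + 1)%Z).
{ unfold quarter_turns. destruct (Z_le_gt_dec 0 m).
  - exists (m - 1)%Z. lia.
  - exists m. lia. }
destruct C as [c [Cm [C1 C2]]].
apply quarter_multiple_le in C1. apply quarter_multiple_le in C2.
rewrite <- phase_abscissa in C1, C2.
pose proof (phase_abscissa m) as Em. rewrite Cm in Em.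
set (e := abscissa m) in *.
(* Move [a] and [b] next to [e], into the two pieces that meet there. *)
set (a' := Rmax a (abscissa (m - 1))).
set (b' := Rmin b (abscissa (m + 1))).
assert (Ha' : a <= a' < e /\ abscissa (m - 1) <= a').
{ unfold a'. split; [split; [apply Rmax_l|]|apply Rmax_r].
  apply Rmax_lub_lt; [exact Ha|]. apply abscissa_increasing; lia. }
assert (Hb' : e < b' <= b /\ b' <= abscissa (m + 1)).
{ unfold b'. split; [split; [|apply Rmin_l]|apply Rmin_r].
  apply Rmin_glb_lt; [exact Hb|]. apply abscissa_increasing; lia. }
assert (Ia' : I a') by (apply (itv a _ b); trivial; lra).
assert (Ib' : I b') by (apply (itv a _ b); trivial; lra).
assert (S1 : 0 < cos (IZR c * PI) * (y0 e - y0 a')).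
{ apply y0_strictly_monotonic.
  - lra.
  - intros x Hx. apply dom, (itv a' x e); trivial.
  - apply Rle_trans with (1 := C1), phase_le_iff; lra.
  - lra. }
assert (S2 : 0 < cos (IZR (c + 1) * PI) * (y0 b' - y0 e)).
{ apply y0_strictly_monotonic.
  - lra.
  - intros x Hx. apply dom, (itv e x b'); trivial.
  - replace (2 * (c + 1) - 1)%Z with (2 * c + 1)%Z by ring. lra.
  - apply Rle_trans with (2 := C2), phase_le_iff; lra. }
rewrite cos_succ_IZR_PI in S2.
assert (rev : (y0 e - y0 a') * (y0 b' - y0 e) < 0).
{ apply Rnot_le_lt. intro H.
  pose proof (Rmult_lt_0_compat _ _ S1 S2).
  pose proof (Rmult_le_pos _ _ (Rle_0_sqr (cos (IZR c * PI))) H) as N.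
  unfold Rsqr in N. nra. }
destruct mono as [M|M];
  pose proof (M a' e Ia' Im ltac:(lra)); pose proof (M e b' Im Ib' ltac:(lra));
  nra.
Qed.

Lemma abscissa_numbering : infsupum_numbering y0_dom y0 abscissa.
Proof.
assert (range : forall e, infsupum_abscissa y0_dom y0 e <->
          exists m, abscissa m = e).
{ apply infsupum_abscissa_of_partition.
  - apply abscissa_increasing.
  - apply abscissa_locate.
  - apply abscissa_gap_nonzero.
  - apply y0_piece.
  - apply no_crossing. }
split; [apply abscissa_increasing|]. split; [exact range|]. split.
- rewrite <- abscissa_0. apply abscissa_increasing. lia.
- intros e He pos. apply range in He. destruct He as [m <-].
  rewrite <- abscissa_0 in pos.
  apply (increasing_Z_reflects abscissa abscissa_increasing) in pos.
  destruct (Z.eq_dec m 1) as [->|ne]; [lra|].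
  left. apply abscissa_increasing. lia.
Qed.

Lemma infsupum_y0 : infsupum y0_dom y0 = abscissa.
Proof.
apply (infsupum_numbering_unique y0_dom y0); [|apply abscissa_numbering].
apply (epsilon_spec _ (infsupum_numbering y0_dom y0)).
exists abscissa. apply abscissa_numbering.
Qed.

(** * The Dottie number *)

Lemma the_spec (P : R -> Prop) : (exists! x, P x) -> P (the P).
Proof.
intros [x [Px _]]. apply (epsilon_spec _ P). exists x; exact Px.
Qed.

Lemma fixpoint_cos_bounds (x : R) : x = cos x -> 0 < x <= 1.
Proof.
intro E. pose proof (COS_bound x). pose proof PI2_1.
assert (0 < cos x) by (apply cos_gt_0; lra). lra.
Qed.

Lemma fixpoint_cos_exists_unique : exists! x : R, x = cos x.
Proof.
destruct (IVT_gen (fun x => x - cos x) 0 1 0) as [d [_ Hd]].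
- apply continuity_minus;
    [apply derivable_continuous, derivable_id | apply continuity_cos].
- rewrite cos_0. pose proof (COS_bound 1).
  rewrite Rmin_left, Rmax_right; lra.
- exists d. split; [lra|]. intros x Ex.
  assert (Ed : d = cos d) by lra.
  pose proof (fixpoint_cos_bounds x Ex). pose proof (fixpoint_cos_bounds d Ed).
  pose proof PI2_1.
  destruct (Rtotal_order d x) as [L|[L|L]]; trivial;
    pose proof L as C; apply cos_decreasing_1 in C; lra.
Qed.

(** A fixed point [x] of [cos] is in branch 1 because its phase is less than
    [x <= 1 < PI/2]. *)
Lemma branch1_value_iff (x : R) :
  branch y0_dom y0 1 x /\ y0 x = -1 <-> x = cos x.
Proof.
unfold branch. rewrite infsupum_y0. unfold y0_dom. simpl Z.sub. rewrite abscissa_0.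
split.
- intros [[nz _] E].
  replace (cos x) with (- (y0 x * x)) by (unfold y0; field; exact nz).
  rewrite E. ring.
- intro E. pose proof (fixpoint_cos_bounds x E) as B.
  split; [split; [lra|split; [lra|]]|].
  + apply phase_lt_iff. rewrite phase_abscissa.
    unfold quarter_turns. simpl. pose proof PI2_1.
    pose proof (phase_increasing 0 x (proj1 B)).
    assert (0 < atan x) by (rewrite <- atan_0; apply atan_increasing; lra).
    unfold phase. lra.
  + unfold y0. rewrite <- E. field. lra.
Qed.

(* The first three conjuncts assert that the objects named in the last one are
   well defined: the numbering of the infsupum abscissas, the Dottie number,
   and the value at -1 of the inverse of y0 on branch 1. *)
Theorem mainTheorem2 :
  (exists! nu : Z -> R, infsupum_numbering y0_dom y0 nu) /\
  (exists! x : R, x = cos x) /\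
  (exists! x : R, branch y0_dom y0 1 x /\ y0 x = -1) /\
  dottie = inverse y0_dom y0 1 (-1).
Proof.
pose proof fixpoint_cos_exists_unique as U.
assert (V : exists! x : R, branch y0_dom y0 1 x /\ y0 x = -1).
{ destruct U as [d [Ed Ud]]. exists d. split.
  - apply branch1_value_iff, Ed.
  - intros x Hx. apply Ud, branch1_value_iff, Hx. }
split; [|split; [exact U|split; [exact V|]]].
- exists abscissa. split; [apply abscissa_numbering|].
  intros nu Hnu.
  apply (infsupum_numbering_unique y0_dom y0);
    [apply abscissa_numbering | exact Hnu].
- pose proof (the_spec _ U) as Hd. pose proof (the_spec _ V) as Hi.
  apply branch1_value_iff in Hi.
  destruct U as [d [_ Ud]].
  transitivity d; [symmetry|]; apply Ud; [exact Hd | exact Hi].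
Qed.
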